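(* Let $k$ be a positive integer and let $G(V,E,w)$ be a weighted $k$-regular graph. Then for every positive integer $n\le k$, $G(V,E,w)$ is not strictly $n$-convex.
   Context: All graphs are finite, simple and connected (with at least one vertex). A weighted graph $G(V,E,w)$ consists of a graph with vertex set $V$ and edge set $E$ together with a weight function $w:V\to\mathbb{R}_+$, where $\mathbb{R}_+=[0,\infty)$. For a positive integer $n$, $G(V,E,w)$ is called strictly $n$-convex if for every vertex $v\in V$ having at least $n$ adjacent vertices, and for every choice of $n$ distinct vertices $v_1,\dots,v_n$ adjacent to $v$, one has $n\cdot w(v)<w(v_1)+\cdots+w(v_n)$. *)

(* Defs.v *)
From HB Require Import structures.
From mathcomp Require Import all_boot all_order all_algebra.
From mathcomp Require Import reals.
Set Implicit Arguments.
Unset Strict Implicit.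
Unset Printing Implicit Defensive.
Import Order.TTheory GRing.Theory Num.Theory.
Local Open Scope ring_scope.

Record graph := Graph {
  vertex :> finType;
  adj : rel vertex;
  adj_sym : symmetric adj;
  adj_irrefl : irreflexive adj;
  graph_nonempty : (0 < #|vertex|)%N;
  graph_connected : forall x y : vertex, connect adj x y
}.

Record weighted_graph (R : realType) := WeightedGraph {
  wgraph :> graph;
  weight : wgraph -> R;
  weight_ge0 : forall v : wgraph, 0 <= weight v
}.

Definition neighbors (G : graph) (v : G) : {set G} := [set u | adj v u].

Definition regular (k : nat) (G : graph) : Prop :=
  forall v : G, #|neighbors v| = k.

Definition strictly_convex (R : realType) (n : nat) (G : weighted_graph R) :
    Prop :=
  forall v : G, (n <= #|neighbors v|)%N ->
  forall t : n.-tuple G, uniq t -> {subset t <= neighbors v} ->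
  n%:R * weight v < \sum_(i < n) weight (tnth t i).

(* Main.v *)
Require Import Defs.
From HB Require Import structures.
From mathcomp Require Import all_boot all_order all_algebra.
From mathcomp Require Import reals.
Import Order.TTheory GRing.Theory Num.Theory.

(** The discrete maximum principle: the vertex set is finite and nonempty, so
    the weight is maximal at some vertex [v]. No neighbor of [v] is heavier
    than [v], so [n] of them weigh at most [n] times [weight v] together, while
    strict convexity at [v] asks for strictly more. Regularity serves to
    provide [n] distinct neighbors of [v], since [n <= k]. *)

Theorem proposition1p2 (R : realType) (k : nat) (hk : (0 < k)%N)
    (G : weighted_graph R) (hG : regular k G)
    (n : nat) (hn : (0 < n)%N) (hnk : (n <= k)%N) :
  ~ strictly_convex n G.
Proof.
move=> convG.
have /card_gt0P [v0 _] := graph_nonempty G.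
have [v max_v] : exists v : G, forall u : G, (weight u <= weight v)%R.
  case: (@arg_maxP _ _ _ v0 predT (@weight R G) isT) => v _ max_v.
  by exists v => u; apply: max_v.
have le_n_deg : (n <= #|neighbors v|)%N by rewrite hG.
have size_t : size (take n (enum (neighbors v))) == n.
  by rewrite size_takel // -cardE.
have := convG v le_n_deg (Tuple size_t).
have sub_t : {subset Tuple size_t <= neighbors v}.
  by move=> u /mem_take; rewrite mem_enum.
move=> /(_ (take_uniq _ (enum_uniq _)) sub_t); apply/negP; rewrite -leNgt.
apply: (le_trans (ler_sum _ (fun i _ => max_v (tnth (Tuple size_t) i)))).
by rewrite sumr_const card_ord mulr_natl.
Qed.
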